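(* For every natural number $t\ge 2$ and every odd natural number $g$ with $3\le g\le t$, there exists a finite simple graph $G$ with edge connectivity $t$ that has a guarding set of size $g$.
   Context: The edge connectivity of a graph is the minimum number of edges whose removal disconnects it. An acyclic orientation of a graph $G=(V,E)$ is an orientation of each edge such that the resulting directed graph has no directed cycle. An edge $e$ is flippable in an acyclic orientation if reversing the orientation of $e$ alone yields again an acyclic orientation. A subset $S\subseteq E$ is a guarding set for $G$ if for every acyclic orientation of $G$ there exists an edge $e\in S$ that is flippable in that orientation. *)

(* Defs.v *)
From mathcomp Require Import all_boot.
Set Implicit Arguments.
Unset Strict Implicit.
Unset Printing Implicit Defensive.

Record sgraph := SGraph {
  vertex :> finType;
  adj : rel vertex;
  adj_sym : symmetric adj;
  adj_irr : irreflexive adj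
}.

Section Graph.
Variable G : sgraph.
Implicit Types (o : rel G) (f : {set G}) (F S : {set {set G}}).

Definition edges : {set {set G}} := [set [set x; y] | x in G, y in G & adj x y].

Definition remove_edges F : rel G :=
  [rel x y | adj x y && ([set x; y] \notin F)].

Definition disconnecting F : Prop :=
  F \subset edges /\ exists x y : G, ~~ connect (remove_edges F) x y.

(* The one-vertex graph has no disconnecting edge set, hence no edge
   connectivity in this sense. *)
Definition has_edge_connectivity (t : nat) : Prop :=
  (exists2 F, disconnecting F & #|F| = t) /\
  (forall F, disconnecting F -> t <= #|F|).

(* o x y means that the edge {x, y} is directed from x to y. *)
Definition orientation o : Prop :=
  (forall x y, o x y -> adj x y) /\ (forall x y, adj x y -> o x y (+) o y x).

Definition acyclic o : Prop := forall c : seq G, ucycle o c -> c = [::].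

Definition acyclic_orientation o : Prop := orientation o /\ acyclic o.

Definition reverse_edge o f : rel G :=
  [rel x y | if [set x; y] == f then o y x else o x y].

Definition flippable o f : Prop := acyclic_orientation (reverse_edge o f).

Definition guarding_set S : Prop :=
  S \subset edges /\
  (forall o, acyclic_orientation o -> exists2 f, f \in S & flippable o f).

End Graph.

(* Main.v *)
Require Import Defs.
From mathcomp Require Import all_boot.

Set Implicit Arguments.
Unset Strict Implicit.
Unset Printing Implicit Defensive.

(** Attach to every vertex [i] of a non-bipartite graph [H] a clique on [t + 2]
    vertices containing [i], all these cliques sharing one further vertex, the
    hub.  The edge connectivity is that of a single clique, namely [t + 1].  The
    edges of [H] are guarding: colour each vertex of [H] by whether it reaches
    the hub; since [H] is not bipartite, some arcs [x -> y] of [H] are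
    monochromatic, and we take one with [y] minimal.  A second directed path
    from [x] to [y] cannot pass through the hub, hence cannot enter the clique
    of [x], so it starts with a monochromatic arc [x -> z] of [H] with [z] below
    [y], contradicting minimality.  So [x -> y] is flippable.  The theorem is
    the case of an odd cycle [H]. *)

Lemma eq_set2P (T : finType) (a b x y : T) :
  reflect (a = x /\ b = y \/ a = y /\ b = x) ([set a; b] == [set x; y]).
Proof.
apply: (iffP eqP) => [E|[[-> ->]|[-> ->]]]; rewrite 1?setUC //.
have := set21 a b; have := set22 a b; rewrite E !inE.
have := set21 x y; have := set22 x y; rewrite -E !inE.
by do 4![case/orP=> /eqP ?]; subst; auto.
Qed.

Lemma set2_injr (T : finType) (x : T) : injective (fun y => [set x; y]).
Proof. by move=> y z /eqP/eq_set2P [[_ ->]|[-> ->]]. Qed.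

Lemma imset_set2 (aT rT : finType) (f : aT -> rT) x y :
  f @: [set x; y] = [set f x; f y].
Proof. by rewrite imsetU1 imset_set1. Qed.

Lemma odd_card_same_color (T : finType) (f : T -> T) (b : pred T) :
  odd #|T| -> injective f -> exists x, b (f x) = b x.
Proof.
move=> oddT f_inj.
case: (pickP [pred x | b (f x) == b x]) => [x /eqP bx|alternating].
  by exists x.
have preim_compl : f @^-1: [set x | b x] = ~: [set x | b x].
  apply/setP => x; rewrite !inE.
  by have := alternating x; rewrite /=; case: (b (f x)); case: (b x).
have := card_preimset [set x | b x] f_inj; rewrite preim_compl => half.
by move: oddT; rewrite -(cardsC [set x | b x]) half addnn odd_double.
Qed.

Section Arcs.
Variable T : finType.
Implicit Type e : rel T.

Definition add_arc e x y : rel T := [rel a b | e a b || ((a, b) == (x, y))].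

Definition del_arc e x y : rel T := [rel a b | e a b && ((a, b) != (x, y))].

Lemma connect_subrel e e' : subrel e e' -> subrel (connect e) (connect e').
Proof. by move=> ee'; apply: connect_sub => x y /ee'; apply: connect1. Qed.

Lemma connect_first_step e x y :
  connect e x y -> x = y \/ exists2 z, e x z & connect e z y.
Proof.
case/connectP=> [[_ ->|z p /= /andP [exz pp] Ey]]; first by left.
by right; exists z => //; apply/connectP; exists p.
Qed.

Lemma connect_add_arc e x y a b :
  connect (add_arc e x y) a b ->
  connect e a b \/ connect e a x /\ connect e y b.
Proof.
case/connectP=> p; elim: p a => [|z p IH] a /=.
  by move=> _ ->; left; apply: connect0.
case/andP=> /orP [eaz|/eqP [-> ->]] pp /(IH _ pp) {IH pp}.
  by have az := connect1 eaz; case=> [zb|[zx yb]]; [left|right; split=> //];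
    apply: connect_trans az _.
by case=> [yb|[_ yb]]; right.
Qed.

Lemma connect_del_arc e x y :
  x != y -> connect (del_arc e x y) x y ->
  exists z, [/\ e x z, z != y & connect e z y].
Proof.
move=> xy /connect_first_step [E|[z /andP [exz zy] czy]].
  by rewrite E eqxx in xy.
exists z; split=> //; first by apply: contraNneq zy => ->.
by apply: connect_subrel czy => a b /andP [].
Qed.

End Arcs.

Section Acyclic.
Variable G : sgraph.
Implicit Types o : rel G.

Lemma acyclicP o : acyclic o <-> forall x y, o x y -> ~~ connect o y x.
Proof.
split=> [ao x y oxy | no_return [|x [|y p]] // /andP [] /=].
- apply/negP => /connectP [p pp Ex].
  case/shortenP: pp Ex => q pq uq _ Ex.
  suff /ao : ucycle o (y :: q) by [].
  by rewrite /ucycle /ucycleb uq andbT /= rcons_path pq -Ex.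
- by rewrite andbT => /no_return; rewrite connect0.
- case/andP=> /no_return /negP nyx pp _; case: nyx.
  by apply/connectP; exists (rcons p x); rewrite ?last_rcons.
Qed.

Lemma acyclic_subrel o o' : subrel o o' -> acyclic o' -> acyclic o.
Proof.
move=> oo' /acyclicP ao'; apply/acyclicP => x y /oo' /ao'.
by apply: contra; apply: connect_subrel.
Qed.

Lemma acyclic_connect_anti o : acyclic o -> antisymmetric (connect o).
Proof.
move=> /acyclicP ao x y /andP [/connect_first_step [//|[z /ao nzx zy]] yx].
by rewrite (connect_trans zy yx) in nzx.
Qed.

Lemma acyclic_add_arc o x y :
  acyclic o -> ~~ connect o y x -> acyclic (add_arc o x y).
Proof.
move=> /acyclicP ao nyx; apply/acyclicP => a b oab.
apply/negP => /connect_add_arc.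
case/orP: oab => [oab|/eqP [-> ->]] [ba|[bx ya]].
- by rewrite (negbTE (ao _ _ oab)) in ba.
- by rewrite (connect_trans ya (connect_trans (connect1 oab) bx)) in nyx.
- by rewrite ba in nyx.
- by rewrite bx in nyx.
Qed.

Lemma acyclic_ex_minimal o (I : finType) (P : pred I) (h : I -> G) i0 :
  acyclic o -> P i0 ->
  exists2 i, P i & forall j, P j -> connect o (h j) (h i) -> h j = h i.
Proof.
move=> ao Pi0.
case: (arg_minnP (fun i => #|[set x | connect o x (h i)]|) Pi0) => i Pi min.
exists i => // j Pj ji; apply: acyclic_connect_anti ao _ _ _; rewrite ji /=.
apply: contraLR (min j Pj) => nij; rewrite -ltnNge; apply/proper_card/properP.
split; last by exists (h i); rewrite inE ?connect0.
by apply/subsetP => x; rewrite !inE => xj; apply: connect_trans xj ji.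
Qed.

Lemma reverse_edge_orientation o f :
  orientation o -> orientation (reverse_edge o f).
Proof.
move=> [oadj oxor]; split=> a b; rewrite /reverse_edge /=.
  by case: ifP => _ /oadj; rewrite // adj_sym.
by move=> /oxor; rewrite [[set b; a]]setUC; case: ifP; rewrite // addbC.
Qed.

Lemma reverse_edge_sub o x y :
  orientation o -> o x y ->
  subrel (reverse_edge o [set x; y]) (add_arc (del_arc o x y) y x).
Proof.
move=> [oadj oxor] oxy a b; rewrite /reverse_edge /=.
case: eq_set2P => [[[-> ->]|[-> ->]] oyx|ne oab].
- by have := oxor _ _ (oadj _ _ oxy); rewrite oxy oyx.
- by rewrite /add_arc /= eqxx orbT.
- rewrite /add_arc /del_arc /= oab /=.
  by case: eqP => // -[Ea Eb]; case: ne; left.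
Qed.

Lemma flippable_no_detour o x y :
  acyclic_orientation o -> o x y ->
  (forall z, o x z -> connect o z y -> z = y) -> flippable o [set x; y].
Proof.
move=> [oo ao] oxy no_detour; split; first exact: reverse_edge_orientation.
apply: acyclic_subrel (reverse_edge_sub oo oxy) _.
apply: acyclic_add_arc; first by apply: acyclic_subrel ao => a b /andP [].
have xy : x != y.
  by apply: contraTneq (oo.1 _ _ oxy) => ->; rewrite adj_irr.
by apply/negP => /(connect_del_arc xy) [z [oxz /eqP zy /(no_detour z oxz)]].
Qed.

End Acyclic.

Section Connectivity.
Variable G : sgraph.
Implicit Types (x y z : G) (F : {set {set G}}).

Definition neighbors x : {set G} := [set y | adj x y].

Definition star x : {set {set G}} := [set [set x; y] | y in neighbors x].

Lemma edgesP (e : {set G}) :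
  reflect (exists x y, adj x y /\ e = [set x; y]) (e \in edges G).
Proof.
apply: (iffP imset2P) => [[x y _]|[x [y [axy ->]]]].
  by rewrite inE => axy ->; exists x, y.
by exists x y; rewrite ?inE.
Qed.

Lemma mem_edges x y : adj x y -> [set x; y] \in edges G.
Proof. by move=> axy; apply/edgesP; exists x, y. Qed.

Lemma card_star x : #|star x| = #|neighbors x|.
Proof. exact/card_imset/set2_injr. Qed.

Lemma disconnecting_star x y : x != y -> disconnecting (star x).
Proof.
move=> xy; split.
  apply/subsetP => _ /imsetP [z + ->]; rewrite inE; exact: mem_edges.
exists x, y; apply/negP => /connect_first_step [E|[z /andP [axz /negP + _]]].
  by rewrite E eqxx in xy.
by apply; apply: imset_f; rewrite inE.
Qed.

Lemma remove_edges_sym F : symmetric (remove_edges F).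
Proof. by move=> x y; rewrite /remove_edges /= adj_sym setUC. Qed.

(* The edge [xy] and the paths [x z y], with [z] a common neighbour, are
   edge-disjoint, so a separating [F] meets each of them in its own element. *)
Lemma connect_remove_edges F x y :
  adj x y -> #|F| <= #|neighbors x :&: neighbors y| ->
  connect (remove_edges F) x y.
Proof.
move=> axy; apply: contraLR => nxy; rewrite -ltnNge.
pose N := y |: neighbors x :&: neighbors y.
have adjx z : z \in N -> adj x z by rewrite !inE => /orP [/eqP ->|/andP []].
pose cut_edge z := if [set x; z] \in F then [set x; z] else [set y; z].
have cut_edgeF z : z \in N -> cut_edge z \in F.
  move=> zN; rewrite /cut_edge; case: ifPn => // xzF.
  apply: contraNT nxy => yzF.
  have xz : remove_edges F x z by rewrite /remove_edges /= adjx.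
  move: zN; rewrite !inE => /orP [/eqP <-|/andP [_ ayz]]; first exact: connect1.
  apply: connect_trans (connect1 xz) (connect1 _).
  by rewrite remove_edges_sym /remove_edges /= ayz.
have cut_edge_inj : {in N &, injective cut_edge}.
  have xN z : z \in N -> z != x.
    by move=> /adjx; apply: contraTneq => ->; rewrite adj_irr.
  have yx : y != x by apply: xN; rewrite setU11.
  move=> z w /xN zx /xN wx; rewrite /cut_edge.
  case: ifP => _; case: ifP => _; try exact: set2_injr.
    by move=> /eqP/eq_set2P [] [E _]; rewrite E eqxx in yx wx.
  by move=> /eqP/eq_set2P [] [E1 E2]; rewrite ?E1 ?E2 eqxx in yx zx.
have <- : #|N| = #|neighbors x :&: neighbors y|.+1.
  by rewrite cardsU1 !inE adj_irr andbF.
rewrite -(card_in_imset cut_edge_inj).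
by apply/subset_leq_card/subsetP => _ /imsetP [z zN ->]; apply: cut_edgeF.
Qed.

Lemma ltn_card_disconnecting (h : G) t F :
  (forall x, x != h -> adj x h && (t <= #|neighbors x :&: neighbors h|)) ->
  disconnecting F -> t < #|F|.
Proof.
move=> near_h [_ [x [y]]]; apply: contraNltn => cardF.
have to_h z : connect (remove_edges F) z h.
  have [->|/near_h /andP [azh tN]] := eqVneq z h; first exact: connect0.
  exact/connect_remove_edges/(leq_trans cardF).
apply: connect_trans (to_h x) _.
by rewrite (sym_connect_sym (@remove_edges_sym F)).
Qed.

Definition bipartite : Prop :=
  exists b : pred G, forall x y, adj x y -> b x != b y.

Lemma not_bipartite_monochromatic (b : pred G) :
  ~ bipartite -> exists x y, adj x y /\ b x = b y.
Proof.
move=> nbip.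
case: (pickP [pred p : G * G | adj p.1 p.2 && (b p.1 == b p.2)]).
  by move=> [x y] /andP [/= axy /eqP bxy]; exists x, y.
move=> proper; case: nbip; exists b => x y axy.
by have := proper (x, y); rewrite /= axy => /negbT.
Qed.

End Connectivity.

Section Flower.
Variables (H : sgraph) (t : nat).

(* [None] is the hub; the clique of [i] consists of the hub and of the vertices
   [Some (i, j)], among which [Some (i, ord0)] stands for [i] itself. *)
Definition flower_adj (x y : option (H * 'I_t.+1)) : bool :=
  match x, y with
  | None, None => false
  | Some (i, j), Some (k, l) =>
      ((i == k) && (j != l)) || [&& j == ord0, l == ord0 & adj i k]
  | _, _ => true
  end.

Lemma flower_adj_sym : symmetric flower_adj.
Proof.
move=> [[i j]|] [[k l]|] //=.
by rewrite adj_sym [i == k]eq_sym [j == l]eq_sym andbCA.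
Qed.

Lemma flower_adj_irr : irreflexive flower_adj.
Proof. by move=> [[i j]|] //=; rewrite adj_irr !eqxx !andbF. Qed.

Definition flower : sgraph := SGraph flower_adj_sym flower_adj_irr.

Definition hub : flower := None.
Definition petal (i : H) (j : 'I_t.+1) : flower := Some (i, j).
Definition rim (i : H) : flower := petal i ord0.

Lemma petal_inj i : injective (petal i).
Proof. by move=> j l []. Qed.

Lemma rim_inj : injective rim.
Proof. by move=> i k []. Qed.

Lemma adj_rim i k : adj (rim i) (rim k) = adj i k.
Proof. by rewrite /= andbF. Qed.

Lemma card_other_petals i j : #|petal i @: [set~ j]| = t.
Proof. by rewrite (card_imset _ (@petal_inj i)) cardsC1 card_ord. Qed.

Lemma card_common_neighbors_hub i j :
  t <= #|neighbors (petal i j) :&: neighbors hub|.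
Proof.
rewrite -{1}(card_other_petals i j); apply/subset_leq_card/subsetP.
by move=> _ /imsetP [l jl ->]; move: jl; rewrite !inE /= eqxx eq_sym => ->.
Qed.

Lemma card_neighbors_inner_petal i j :
  j != ord0 -> #|neighbors (petal i j)| = t.+1.
Proof.
move=> j0; have -> : neighbors (petal i j) = hub |: petal i @: [set~ j].
  apply/setP => -[[k l]|]; rewrite !inE //= (negbTE j0) orbF.
  apply/andP/imsetP => [[/eqP <- jl]|[l' + [-> ->]]].
    by exists l; rewrite // !inE eq_sym.
  by rewrite !inE eq_sym.
by rewrite cardsU1 card_other_petals; case: imsetP => // -[].
Qed.

Lemma flower_edge_connectivity (i : H) :
  0 < t -> has_edge_connectivity flower t.+1.
Proof.
move=> t0; split=> [|F]; last first.
  apply: (@ltn_card_disconnecting _ hub) => -[[k l] _|//].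
  exact: card_common_neighbors_hub.
exists (star (petal i ord_max)); first exact: (@disconnecting_star _ _ hub).
by rewrite card_star card_neighbors_inner_petal // -val_eqE /= -lt0n.
Qed.

Definition rim_edges : {set {set flower}} :=
  [set rim @: (e : {set H}) | e in edges H].

Lemma card_rim_edges : #|rim_edges| = #|edges H|.
Proof. exact/card_imset/imset_inj/rim_inj. Qed.

Lemma mem_rim_edges i k : adj i k -> [set rim i; rim k] \in rim_edges.
Proof. by move=> aik; rewrite -imset_set2; apply/imset_f/mem_edges. Qed.

Lemma rim_edges_sub : rim_edges \subset edges flower.
Proof.
apply/subsetP => _ /imsetP [_ /edgesP [i [k [aik ->]]] ->].
by rewrite imset_set2; apply: mem_edges; rewrite adj_rim.
Qed.

(* The clique of [i] can only be left through [rim i] and the hub. *)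
Lemma connect_petal_rim (o : rel flower) i j k :
  subrel o (@adj flower) -> connect o (petal i j) (rim k) ->
  connect o (petal i j) (rim i) \/
  connect o (petal i j) hub /\ connect o hub (rim k).
Proof.
move=> oadj /connectP [p]; elim: p j => [|z p IH] j /=.
  by move=> _ [_ <-]; left; apply: connect0.
case/andP=> ojz pp Ek; have jz := connect1 ojz.
case: z ojz jz pp Ek => [[m l]|] ojz jz pp Ek; last first.
  by right; split=> //; apply/connectP; exists p.
case/orP: (oadj _ _ ojz) => [/andP [/eqP Em _]|/andP [/eqP -> _]]; last first.
  by left; apply: connect0.
subst m; case: (IH l pp Ek) => [li|[lh hk]]; [left|right; split=> //];
  exact: connect_trans jz _.
Qed.

Section Guard.
Variable o : rel flower.
Hypothesis ao : acyclic_orientation o.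

Definition reaches_hub : pred H := [pred i | connect o (rim i) hub].

Definition monochromatic_arc : pred (H * H) :=
  [pred a | o (rim a.1) (rim a.2) && (reaches_hub a.1 == reaches_hub a.2)].

Lemma ex_monochromatic_arc : ~ bipartite H -> exists a, monochromatic_arc a.
Proof.
move=> /(not_bipartite_monochromatic reaches_hub) [i [k [aik bik]]].
have : adj (rim i) (rim k) by rewrite adj_rim.
move/ao.1.2; have [oik _|_ /= oki] := boolP (o (rim i) (rim k)).
  by exists (i, k); rewrite /monochromatic_arc /= oik bik eqxx.
by exists (k, i); rewrite /monochromatic_arc /= oki bik eqxx.
Qed.

Lemma same_color_avoids_hub i k :
  reaches_hub i = reaches_hub k -> reaches_hub i -> ~~ connect o hub (rim k).
Proof.
move=> -> kh; apply/negP => hk.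
by have := acyclic_connect_anti ao.2 (introT andP (conj kh hk)).
Qed.

Lemma same_color_detour_on_rim i k z :
  reaches_hub i = reaches_hub k -> o (rim i) z -> connect o z (rim k) ->
  exists m, z = rim m.
Proof.
move=> bik oiz zk; have iz := connect1 oiz.
case: z oiz iz zk => [[m l]|] oiz iz zk; last first.
  by rewrite (negbTE (same_color_avoids_hub bik iz)) in zk.
case/orP: (ao.1.1 _ _ oiz) => [/andP [/eqP Em _]|/and3P [_ /eqP -> _]].
  subst m; case: (connect_petal_rim ao.1.1 zk) => [li|[lh hk]].
    by have /acyclicP /(_ _ _ oiz) := ao.2; rewrite li.
  by rewrite (negbTE (same_color_avoids_hub bik (connect_trans iz lh))) in hk.
by exists m.
Qed.

Lemma flippable_rim_edge :
  ~ bipartite H -> exists2 f, f \in rim_edges & flippable o f.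
Proof.
case/ex_monochromatic_arc => a0 mono0.
have [[i k] /andP [/= oik /eqP bik] min] :=
  acyclic_ex_minimal (fun a => rim a.2) ao.2 mono0.
exists [set rim i; rim k].
  by apply: mem_rim_edges; rewrite -adj_rim; apply: ao.1.1.
apply: flippable_no_detour => // z oiz zk.
have [m Ez] := same_color_detour_on_rim bik oiz zk; subst z.
have bim : reaches_hub i = reaches_hub m.
  apply/idP/idP => [|mh]; last exact: connect_trans (connect1 oiz) mh.
  by rewrite bik; apply: connect_trans zk.
by apply: (min (i, m)) zk; rewrite /monochromatic_arc /= oiz bim eqxx.
Qed.

End Guard.

Lemma guarding_rim_edges : ~ bipartite H -> guarding_set rim_edges.
Proof.
move=> nbip; split; first exact: rim_edges_sub.
by move=> o ao; apply: flippable_rim_edge.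
Qed.

End Flower.

Section CycleGraph.
Variable n : nat.

Definition cycle_adj (i k : 'I_n) : bool :=
  (i != k) && ((ordS i == k) || (ordS k == i)).

Lemma cycle_adj_sym : symmetric cycle_adj.
Proof. by move=> i k; rewrite /cycle_adj eq_sym orbC. Qed.

Lemma cycle_adj_irr : irreflexive cycle_adj.
Proof. by move=> i; rewrite /cycle_adj eqxx. Qed.

Definition cycle_graph : sgraph := SGraph cycle_adj_sym cycle_adj_irr.

Lemma val_iter_ordS k (i : 'I_n) : iter k (@ordS n) i = (i + k) %% n :> nat.
Proof.
elim: k => [|k IH] /=; first by rewrite addn0 modn_small.
by rewrite IH -addn1 modnDml addn1 addnS.
Qed.

Lemma iter_ordS_neq k (i : 'I_n) : 0 < k < n -> iter k (@ordS n) i != i.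
Proof.
case/andP=> k_gt0 k_lt_n; rewrite -(inj_eq (@ord_inj n)) val_iter_ordS.
rewrite -[X in _ != X](modn_small (ltn_ord i)) -[X in _ != X %% n]addn0.
by rewrite eqn_modDl mod0n modn_small // -lt0n.
Qed.

Lemma cycle_adj_ordS (i : 'I_n) : 1 < n -> cycle_adj i (ordS i).
Proof. by move=> n1; rewrite /cycle_adj eqxx eq_sym (@iter_ordS_neq 1). Qed.

Lemma edges_cycle_graph :
  1 < n -> edges cycle_graph = [set [set i; ordS i] | i : 'I_n].
Proof.
move=> n1; apply/setP => e; apply/edgesP/imsetP => [|[i _ ->]].
  case=> i [k [/andP [_ /orP [] /eqP <-] ->]]; first by exists i.
  by exists k; rewrite // setUC.
by exists i, (ordS i); split=> //; apply: cycle_adj_ordS.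
Qed.

Lemma card_edges_cycle_graph : 2 < n -> #|edges cycle_graph| = n.
Proof.
move=> n2; rewrite (edges_cycle_graph (ltnW n2)) card_imset ?card_ord //.
move=> i k /eqP/eq_set2P [[]//|[Ei Ek]].
by have := @iter_ordS_neq 2 k n2; rewrite /= -Ei Ek eqxx.
Qed.

Lemma odd_cycle_graph_not_bipartite : 1 < n -> odd n -> ~ bipartite cycle_graph.
Proof.
move=> n1 odd_n [b proper].
have [|i bi] := @odd_card_same_color _ _ b _ (@ordS_inj n).
  by rewrite card_ord.
by have := proper _ _ (cycle_adj_ordS i n1); rewrite bi eqxx.
Qed.

End CycleGraph.

Theorem theorem6 (t g : nat) (ht : 2 <= t) (g_odd : odd g) (hg : 3 <= g <= t) :
  exists G : sgraph, has_edge_connectivity G t /\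
    exists S : {set {set G}}, guarding_set S /\ #|S| = g.
Proof.
case: t ht hg => [|t] // t_gt0 /andP [g_gt2 _].
pose i0 : cycle_graph g := Ordinal (ltnW (ltnW g_gt2)).
exists (flower (cycle_graph g) t); split.
  exact: flower_edge_connectivity i0 t_gt0.
exists (rim_edges (cycle_graph g) t); split.
  exact/guarding_rim_edges/odd_cycle_graph_not_bipartite/g_odd/ltnW.
by rewrite card_rim_edges card_edges_cycle_graph.
Qed.
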